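(* Let $\tau=2\,\mathrm{Tr}$ on $M_2$ and let $\mathcal{G}$ be a loopfree quantum graph on the (tracial) quantum set $(M_2,\tau)$. For $\beta\in[0,1]$ let $\mathcal{G}_{0,\beta}^{(1B)}$ be the quantum graph on $(M_2,\tau)$ with quantum edge space $\mathrm{span}\left\{\begin{pmatrix}0&1+\beta\\1-\beta&0\end{pmatrix}\right\}$. (1) If $\mathcal{G}$ has exactly one quantum edge, then it is isomorphic to exactly one of the quantum graphs $\mathcal{G}_{0,\beta}^{(1B)}$ with $\beta\in[0,1]$. The quantum graph $\mathcal{G}_{0,\beta}^{(1B)}$ has quantum adjacency matrix $$A_{0,\beta}^{(1B)}=\frac{1}{1+\beta^2}\begin{pmatrix}0&0&0&(1+\beta)^2\\0&0&1-\beta^2&0\\0&1-\beta^2&0&0\\(1-\beta)^2&0&0&0\end{pmatrix},$$ it is undirected if and only if $\beta=0$, and (the quantum adjacency matrix of) $\mathcal{G}_{0,\beta}^{(1B)}$ has spectrum (eigenvalues listed with multiplicity) $$\sigma_\beta=\frac{1}{1+\beta^2}\left\{1-\beta^2,\,1-\beta^2,\,\beta^2-1,\,\beta^2-1\right\}.$$ (2) If $\mathcal{G}$ has two quantum edges, then it is isomorphic to the loopfree complement of one of the quantum graphs from (1). (3) If $\mathcal{G}$ has three quantum edges, then it is the complete loopfree quantum graph on $(M_2,\tau)$, i.e. its quantum edge space is $\{x\in M_2:\mathrm{Tr}(x)=0\}$.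
   Context: $M_2$ is the algebra of complex $2\times2$ matrices, $\mathrm{Tr}$ the unnormalized trace. Write $\tau=\mathrm{Tr}(\rho\,\cdot)$ with $\rho=2\mathrm{I}_2$. A quantum graph on $(M_2,\tau)$ is given by its quantum edge space, an arbitrary linear subspace $S\subset M_2$; the number of quantum edges is $\dim S$. The KMS-inner product induced by $\tau^{-1}$ on $M_2$ is $\langle x,y\rangle=\mathrm{Tr}(x^*\rho^{-1/2}y\rho^{-1/2})=\frac12\mathrm{Tr}(x^*y)$; orthogonal complements of edge spaces are taken with respect to it. If $(X_i)_i$ is an orthonormal basis of $S$ for this inner product, the quantum adjacency matrix is the linear map $A:M_2\to M_2$, $x\mapsto\sum_i\rho^{-1/4}X_i\rho^{1/4}x\rho^{1/4}X_i^*\rho^{-1/4}=\sum_iX_ixX_i^*$ (independent of the choice of basis). It is written as a $4\times4$ matrix in the ordered basis $e_{11},e_{12},e_{21},e_{22}$, so that $A=\sum_iX_i\otimes\overline{X_i}$ (Kronecker product). The quantum graph is loopfree if $\mathrm{I}_2\perp S$, and undirected if $S=S^*:=\{x^*:x\in S\}$. Two quantum graphs on $(M_2,\tau)$ with edge spaces $S_1,S_2$ are isomorphic if there is a $*$-automorphism $\pi$ of $M_2$ with $\tau\circ\pi=\tau$ and $\pi(S_1)=S_2$. The loopfree complement of a loopfree quantum graph with edge space $S$ is the quantum graph with edge space $S'$, where $S^\perp=S'\oplus\mathbb{C}\mathrm{I}_2$ is an orthogonal direct sum. *)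

(* Defs.v *)
From mathcomp Require Import all_boot all_order all_algebra.
From mathcomp Require Import all_real_closed.
From mathcomp Require Import reals exp.

Set Implicit Arguments.
Unset Strict Implicit.
Unset Printing Implicit Defensive.

Import Order.TTheory GRing.Theory Num.Theory.

Local Open Scope ring_scope.
Local Open Scope complex_scope.
Local Open Scope sesquilinear_scope.

Section QuantumGraphsM2.
Variable R : realType.
Local Notation C := R[i].
Local Notation M2 := 'M[C]_2.

(* The density is rho = 2 I, a positive scalar matrix, so that its real powers
   are the scalar matrices rho^t = 2^t I. *)
Definition rho_pow (t : R) : M2 := ((2 `^ t)%:C)%:M.

Definition rho : M2 := 2%:M.

Definition tau (x : M2) : C := \tr (rho *m x).

(* KMS inner product induced by tau^-1 = Tr(rho^-1 .), linear in y;
   x ^t* is the conjugate transpose. *)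
Definition kms (x y : M2) : C :=
  \tr (x ^t* *m rho_pow (- 2^-1) *m y *m rho_pow (- 2^-1)).

(* A quantum graph on (M_2, tau) is given by its quantum edge space
   S : {vspace M2}; its number of quantum edges is \dim S. *)

Definition loopfree (S : {vspace M2}) : Prop :=
  forall x, x \in S -> kms 1%:M x = 0.

Definition undirected (S : {vspace M2}) : Prop :=
  forall y, y \in S <-> exists2 x, x \in S & y = x ^t*.

Definition qgraph_isomorphic (S1 S2 : {vspace M2}) : Prop :=
  exists f : {lrmorphism M2 -> M2},
    [/\ bijective f, forall x, f (x ^t*) = (f x) ^t*,
        forall x, tau (f x) = tau x & (linfun f @: S1)%VS = S2].

Definition loopfree_complement (S S' : {vspace M2}) : Prop :=
  [/\ forall x, x \in (S' + <[1%:M : M2]>)%VS <->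
        (forall s, s \in S -> kms s x = 0),
      directv (S' + <[1%:M : M2]>) &
      forall x, x \in S' -> kms 1%:M x = 0].

Definition complete_loopfree (S : {vspace M2}) : Prop :=
  forall x, x \in S <-> \tr x = 0.

Definition orthonormal_basis (S : {vspace M2}) (X : seq M2) : Prop :=
  basis_of S X /\
  forall i j, (i < size X)%N -> (j < size X)%N ->
    kms X`_i X`_j = (i == j)%:R.

Definition adjacency_map (X : seq M2) (x : M2) : M2 :=
  \sum_(Y <- X) rho_pow (- 4^-1) *m Y *m rho_pow (4^-1) *m x *m
                rho_pow (4^-1) *m Y ^t* *m rho_pow (- 4^-1).

(* Matrix acting on column vectors of coordinates in the ordered basis
   e_11, e_12, e_21, e_22: with indices starting at 0, the k-th basis vector
   is the matrix unit at row k %/ 2 and column k %% 2. *)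
Definition matrix_of_map (f : M2 -> M2) : 'M[C]_4 :=
  \matrix_(k < 4, l < 4)
    f (delta_mx (inord (l %/ 2)) (inord (l %% 2)))
      (inord (k %/ 2)) (inord (k %% 2)).

(* A relation rather than a function, because of the choice of an orthonormal
   basis, on which the matrix does not depend. *)
Definition is_adjacency_matrix (S : {vspace M2}) (A : 'M[C]_4) : Prop :=
  exists2 X, orthonormal_basis S X & A = matrix_of_map (adjacency_map X).

(* s lists the eigenvalues of A with algebraic multiplicity. *)
Definition has_spectrum n (A : 'M[C]_n) (s : seq C) : Prop :=
  char_poly A = \prod_(a <- s) ('X - a%:P).

Definition mx_of_rows n (rows : seq (seq C)) : 'M[C]_n :=
  \matrix_(i < n, j < n) (nth [::] rows i)`_j.

Definition G1B (beta : R) : {vspace M2} :=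
  let b := beta%:C in
  <[ (mx_of_rows 2 [:: [:: 0    ; 1 + b];
                       [:: 1 - b; 0    ]])%R ]>%VS.

Definition A1B (beta : R) : 'M[C]_4 :=
  let b := beta%:C in
  (1 + b ^+ 2)^-1 *:
  mx_of_rows 4 [:: [:: 0           ; 0         ; 0         ; (1 + b) ^+ 2];
                   [:: 0           ; 0         ; 1 - b ^+ 2; 0           ];
                   [:: 0           ; 1 - b ^+ 2; 0         ; 0           ];
                   [:: (1 - b) ^+ 2; 0         ; 0         ; 0           ]].

Definition sigma1B (beta : R) : seq C :=
  let b := beta%:C in
  [seq (1 + b ^+ 2)^-1 * a
     | a <- [:: 1 - b ^+ 2; 1 - b ^+ 2; b ^+ 2 - 1; b ^+ 2 - 1]].

End QuantumGraphsM2.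

(* Main.v *)
(** Loop-free edge spaces consist of traceless matrices, and conjugating by a
    unitary [U] is an isomorphism of quantum graphs.  A traceless matrix is
    unitarily conjugate to one with zero diagonal: after a Schur
    triangularization to [[a, 0], [z, -a]], the vanishing of the (0,0) entry is
    a real quadratic equation.  A swap and a diagonal unitary then make the two
    off-diagonal entries nonnegative multiples of a common phase, the first one
    dominating, which is [c *: [[0, 1 + b], [1 - b, 0]]] with [0 <= b <= 1].
    Uniqueness of [b] comes from the two quantities [|tr (x^2)|] and
    [tr (x^* x)], which an isomorphism preserves.  A two-dimensional [S] is
    treated through a traceless [x] orthogonal to it: the unitary that brings
    [x] to normal form maps [S] to the complement of that normal form. *)

Require Import Defs.
From HB Require Import structures.
From mathcomp Require Import all_boot all_order all_algebra.
From mathcomp Require Import all_real_closed.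
From mathcomp Require Import reals exp.
From mathcomp Require Import ring zify.

Set Implicit Arguments.
Unset Strict Implicit.
Unset Printing Implicit Defensive.

Import Order.TTheory GRing.Theory Num.Theory.

Local Open Scope ring_scope.
Local Open Scope sesquilinear_scope.

(** * Entries, traces and determinants of matrices of size 2 and 4 *)

Lemma forall_ord2 (P : 'I_2 -> Prop) : P 0 -> P 1 -> forall i, P i.
Proof.
by move=> P0 P1 [[|[|//]] lti]; [move: P0|move: P1]; congr P; apply: val_inj.
Qed.

(** The indices stay in [inord] form so that [inordK] turns them into numerals, on which the
    quotients and remainders of [matrix_of_map] compute. *)
Lemma forall_ord4 (P : 'I_4 -> Prop) :
  P (inord 0) -> P (inord 1) -> P (inord 2) -> P (inord 3) -> forall i, P i.
Proof.
move=> P0 P1 P2 P3 i; rewrite -(inord_val i).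
by case: i => [[|[|[|[|//]]]] lti].
Qed.

Lemma eq_mx2 (T : Type) (A B : 'M[T]_2) :
  A 0 0 = B 0 0 -> A 0 1 = B 0 1 -> A 1 0 = B 1 0 -> A 1 1 = B 1 1 -> A = B.
Proof. by move=> *; apply/matrixP; do 2!apply: forall_ord2. Qed.

Lemma mulmx2E (K : pzRingType) (A B : 'M[K]_2) i j :
  (A *m B) i j = A i 0 * B 0 j + A i 1 * B 1 j.
Proof.
rewrite mxE big_ord_recl big_ord1.
by congr (_ + A i _ * B _ j); apply: val_inj.
Qed.

Lemma mxtrace2E (K : nmodType) (A : 'M[K]_2) : \tr A = A 0 0 + A 1 1.
Proof.
by rewrite /mxtrace big_ord_recl big_ord1; congr (_ + A _ _); apply: val_inj.
Qed.

Lemma adjointZ (C : numClosedFieldType) m n (k : C) (A : 'M[C]_(m, n)) :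
  (k *: A)^t* = k^*%R *: A^t*.
Proof. by apply/matrixP=> i j; rewrite !mxE rmorphM. Qed.

(** With [B] the adjoint of [A], these are the entries of the Kronecker product of [A] with its
    conjugate; adjacency matrices are computed this way. *)
Lemma mulmx_delta_mx (K : pzRingType) (A B : 'M[K]_2) i j p q :
  (A *m delta_mx i j *m B) p q = A p i * B j q.
Proof.
move: i j; do 2!apply: forall_ord2; rewrite !mulmx2E !mxE /=.
all: by rewrite ?(mulr0, mulr1, mul0r, add0r, addr0).
Qed.

(* Laplace expansion for entries indexed by [nat] instead of ['I_n], so that
   [simpl] computes the entries of the minors. *)
Fixpoint det_nat (K : comPzRingType) (n : nat) (e : nat -> nat -> K) : K :=
  if n isn't m.+1 then 1 else
  \sum_(j < m.+1)
    e 0 j * ((-1) ^+ j * det_nat m (fun i k => e i.+1 (bump j k))).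

Arguments det_nat : simpl never.

Lemma det_natS (K : comPzRingType) n (e : nat -> nat -> K) :
  det_nat n.+1 e = \sum_(j < n.+1)
    e 0 j * ((-1) ^+ j * det_nat n (fun i k => e i.+1 (bump j k))).
Proof. by []. Qed.

Lemma det_natE (K : comPzRingType) n (e : nat -> nat -> K) :
  \det (\matrix_(i < n, j < n) e i j) = det_nat n e.
Proof.
elim: n e => [|n IHn] e; first exact: det_mx00.
rewrite (expand_det_row _ ord0) det_natS; apply: eq_bigr => j _.
rewrite mxE /cofactor add0n -IHn; congr (_ * (_ * \det _)).
by apply/matrixP=> i k; rewrite !mxE.
Qed.

(** The indices 0, 3 and the indices 1, 2 decouple, which leaves two 2 by 2 minors. The
    characteristic matrix of [A1B] has this shape. *)
Lemma det_cross (K : comPzRingType) (a b c d p q r s : K) :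
  \det (\matrix_(i < 4, j < 4)
    (nth [::] [:: [:: a; 0; 0; b];
                  [:: 0; c; d; 0];
                  [:: 0; p; q; 0];
                  [:: r; 0; 0; s]] i)`_j) = (a * s - b * r) * (c * q - d * p).
Proof.
rewrite (det_natE 4 (fun i j => (nth [::] _ i)`_j)).
rewrite det_natS !big_ord_recl big_ord0 /= !mul0r !addr0 !add0r.
do 3!rewrite !det_natS !big_ord_recl !big_ord0 /= ?(mul0r, mulr0, addr0, add0r).
by rewrite /det_nat; ring.
Qed.

(** * Unitary normal form of traceless 2 by 2 matrices *)

Section UnitaryReduction.
Variable C : numClosedFieldType.
Implicit Types A U : 'M[C]_2.

Definition mx2 (a b c d : C) : 'M[C]_2 :=
  \matrix_(i, j) if i == 0 then if j == 0 then a else b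
                 else if j == 0 then c else d.

Lemma mxtrace_unitary_conj n (U A : 'M[C]_n) : U \is unitarymx ->
  \tr (U *m A *m U^t*) = \tr A.
Proof.
move=> Uu; rewrite mxtrace_mulC mulmxA.
by rewrite (mulmx1C (unitarymxP Uu)) mul1mx.
Qed.

Lemma unitary_conj_comp n (U V A : 'M[C]_n) :
  (V *m U) *m A *m (V *m U)^t* = V *m (U *m A *m U^t*) *m V^t*.
Proof. by rewrite trmx_mul map_mxM /= !mulmxA. Qed.

Lemma unitary_conjK n (U A : 'M[C]_n) : U \is unitarymx ->
  U^t* *m (U *m A *m U^t*) *m U = A.
Proof.
move=> /unitarymxP /mulmx1C UU.
by rewrite !mulmxA UU mul1mx -mulmxA UU mulmx1.
Qed.

Lemma adjoint_mx2 (a b c d : C) : (mx2 a b c d)^t* = mx2 a^* c^* b^* d^*.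
Proof. by apply: eq_mx2; rewrite !mxE. Qed.

(** Completes a unit row vector to an element of SU(2). *)
Lemma unitary_mx2 (x y : C) : x * x^* + y * y^* = 1 ->
  mx2 x y (- y^*) x^* \is unitarymx.
Proof.
move=> xy1; apply/unitarymxP; apply: eq_mx2;
  rewrite mulmx2E !mxE /= ?rmorphN /= ?conjCK //; first by ring.
- by ring.
- by rewrite -xy1; ring.
Qed.

Lemma traceless_zero_corner A : \tr A = 0 ->
  exists2 U : 'M[C]_2, U \is unitarymx & (U *m A *m U^t*) 0 0 = 0.
Proof.
move=> trA0; have [P Pu] := Schur A isT.
rewrite /= /similar_to conjymx // => /is_trig_mxP /(_ 0 1 isT).
set B := P *m A *m P^t* => B01.
have B11 : B 1 1 = - B 0 0.
  by have := mxtrace_unitary_conj A Pu; rewrite -/B mxtrace2E trA0 => /eqP;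
     rewrite addrC addr_eq0 => /eqP.
have [a0|a0] := eqVneq (B 0 0) 0; first by exists P.
(* Unitaries compose, so the lower triangular [B] may replace [A]. *)
suff [U Uu UB] : exists2 U : 'M[C]_2, U \is unitarymx &
                                      (U *m B *m U^t*) 0 0 = 0.
  by exists (U *m P); [exact: mul_unitarymx | rewrite unitary_conj_comp].
clearbody B; set a := B 0 0 in a0 B11; pose w := B 1 0 / a.
have zE : B 1 0 = w * a by rewrite divfK.
(* The phase [u] rotates [w] onto its modulus, so that the quadratic equation for [t] has real
   coefficients. *)
have [u [u1 uw]] : exists u : C, u * u^* = 1 /\ u * w = `|w|.
  have [w0|w0] := eqVneq w 0.
    by exists 1; rewrite conjC1 mulr1 mul1r w0 normr0.
  have n0 : `|w| != 0 by rewrite normr_eq0.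
  exists (w^* / `|w|); split.
    by rewrite -normCK normrM normfV normr_id norm_conjC divff ?expr1n.
  by rewrite mulrAC [_^* * _]mulrC -normCK expr2 mulfK.
(* For the first row [(t, u) / m] of [U], the corner entry is
   [a / m ^+ 2 * (t ^+ 2 + `|w| * t - 1)]. *)
have [t tr tE] : exists2 t : C, t^* = t & t ^+ 2 + `|w| * t = 1.
  (* The discriminant [|w| ^+ 2 + 4] is positive, so the roots are real; the larger one is taken. *)
  pose r := sqrtC (`|w| ^+ 2 + 4).
  have r0 : 0 <= r by rewrite sqrtC_ge0 addr_ge0 ?exprn_ge0.
  exists ((r - `|w|) / 2).
    by rewrite fmorph_div rmorphB /= !conj_Creal ?ger0_real.
  have : r ^+ 2 = `|w| ^+ 2 + 4 by rewrite sqrtCK.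
  by move=> rr; field: rr.
have t1 : 0 < t ^+ 2 + 1.
  by rewrite ltr_wpDl // real_exprn_even_ge0 //; apply/CrealP.
(* [m] is the length of the row [(t, u)], since [t] is real and [u] has modulus 1. *)
have [m [mr mm m0]] : exists m : C, [/\ m^* = m, m * m = t ^+ 2 + 1 & m != 0].
  exists (sqrtC (t ^+ 2 + 1)); split; last by rewrite sqrtC_eq0 gt_eqF.
    by rewrite conj_Creal // ger0_real // sqrtC_ge0 ltW.
  by rewrite -expr2 sqrtCK.
exists (mx2 (t / m) (u / m) (- (u / m)^*) (t / m)^*).
  apply: unitary_mx2; rewrite !fmorph_div /= tr mr.
  rewrite (_ : _ + _ = (t ^+ 2 + u * u^*) / (m * m)); last by field.
  by rewrite u1 mm divff ?gt_eqF.
rewrite !mulmx2E !mxE /= !fmorph_div /= tr mr B01 B11 zE -/a.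
rewrite (_ : _ + _ = a / (m * m) * (t ^+ 2 + (u * w) * t - u * u^*));
  last by field.
by rewrite u1 uw tE subrr mulr0.
Qed.

Lemma unitary_swap : mx2 0 1 1 0 \is unitarymx.
Proof.
apply/unitarymxP; apply: eq_mx2; rewrite mulmx2E !mxE /= ?conjC0 ?conjC1; ring.
Qed.

Lemma unitary_diag (u : C) : u * u^* = 1 -> mx2 1 0 0 u \is unitarymx.
Proof.
move=> uu; apply/unitarymxP; apply: eq_mx2;
  rewrite mulmx2E !mxE /= ?conjC0 ?conjC1 ?uu; ring.
Qed.

Lemma phase_neq0 (u : C) : u * u^* = 1 -> u != 0.
Proof. by apply: contra_eq_neq => ->; rewrite mul0r eq_sym oner_eq0. Qed.

Lemma exists_phase (z : C) : exists2 u : C, u * u^* = 1 & z = `|z| * u.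
Proof.
have [->|z0] := eqVneq z 0.
  by exists 1; rewrite ?conjC1 ?normr0 ?mul0r ?mulr1.
have n0 : `|z| != 0 by rewrite normr_eq0.
exists (z / `|z|); last by rewrite mulrC divfK.
by rewrite -normCK normrM normfV normr_id divff ?expr1n.
Qed.

(** Once one diagonal entry vanishes, so does the other, by the trace. Conjugating by the swap
    exchanges the off-diagonal entries if the lower one has the larger modulus. *)
Lemma traceless_zero_diagonal A : \tr A = 0 ->
  exists U : 'M[C]_2, let B := U *m A *m U^t* in
    [/\ U \is unitarymx, B 0 0 = 0, B 1 1 = 0 & `|B 1 0| <= `|B 0 1|].
Proof.
move=> trA0; have [U Uu A00] := traceless_zero_corner trA0.
have := mxtrace_unitary_conj A Uu; rewrite mxtrace2E trA0 A00 add0r => A11.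
have [le|lt] := real_leP (normr_real ((U *m A *m U^t*) 1 0))
                         (normr_real ((U *m A *m U^t*) 0 1)).
  by exists U.
exists (mx2 0 1 1 0 *m U); rewrite unitary_conj_comp.
move: (U *m A *m U^t*) A00 A11 lt => B B00 B11 lt.
split; first by rewrite mul_unitarymx ?unitary_swap.
all: rewrite !mulmx2E !mxE /= ?conjC0 ?conjC1.
all: rewrite ?(mul0r, mulr0, mul1r, mulr1, add0r, addr0) //.
exact: ltW.
Qed.

Lemma traceless_normal_form A : \tr A = 0 -> A != 0 ->
  exists U (c b : C), [/\ U \is unitarymx, c != 0, 0 <= b <= 1 &
    U *m A *m U^t* = c *: mx2 0 (1 + b) (1 - b) 0].
Proof.
move=> trA0 A0; have [U [Uu A00 A11]] := traceless_zero_diagonal trA0.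
have : U *m A *m U^t* != 0.
  apply: contraNneq A0 => UA0.
  by rewrite -(unitary_conjK A Uu) UA0 mulmx0 mul0mx.
move UAU: (U *m A *m U^t*) A00 A11 => B B00 B11 B0 qp.
have [al al1 pE] := exists_phase (B 0 1).
have [be be1 qE] := exists_phase (B 1 0).
set p := `|B 0 1| in pE qp *; set q := `|B 1 0| in qE qp *.
have q0 : 0 <= q by exact: normr_ge0.
have p0 : 0 < p.
  rewrite lt_def (le_trans q0 qp) andbT; apply: contraNneq B0 => p0.
  have {}q0 : q = 0 by apply: le_anti; rewrite q0 -p0 qp.
  by apply/eqP/eq_mx2; rewrite ?B00 ?B11 ?pE ?qE ?p0 ?q0 ?mul0r mxE.
have pq0 : 0 < p + q by rewrite ltr_wpDr.
(* Conjugating by [diag(1, u)] multiplies the upper entry by the conjugate of [u] and the lower one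
   by [u]. A square root [u] of [al / be] gives both the phase [u * be]. *)
have [u u1 uu] : exists2 u : C, u * u^* = 1 & u * be = al * u^*.
  have be0 := phase_neq0 be1.
  have phase1 (z : C) : z * z^* = 1 -> `|z| = 1.
    by rewrite -normCK => /eqP; rewrite pexpr_eq1 // => /eqP.
  pose u := sqrtC (al / be).
  have u2 : u ^+ 2 = al / be by rewrite sqrtCK.
  have u1 : u * u^* = 1.
    by rewrite -normCK -normrX u2 normrM normfV !phase1 ?divr1.
  exists u => //; rewrite -[al](divfK be0) -u2.
  by rewrite -[LHS]mulr1 -u1; ring.
clearbody p q.
(* Here [c] and [b] solve [c * (1 + b) = p * (u * be)] and [c * (1 - b) = q * (u * be)]; the bounds
   on [b] come from [0 <= q <= p]. *)
exists (mx2 1 0 0 u *m U), ((p + q) / 2 * (u * be)), ((p - q) / (p + q)); split.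
- by rewrite mul_unitarymx ?unitary_diag.
- by rewrite !mulf_eq0 !negb_or invr_eq0 pnatr_eq0 gt_eqF // !phase_neq0.
- rewrite divr_ge0 ?subr_ge0 ?(ltW pq0) //= ler_pdivrMr // mul1r.
  by rewrite lerD2l ge0_cp //.
rewrite unitary_conj_comp UAU.
have pq_neq0 : p + q != 0 by rewrite gt_eqF.
apply: eq_mx2; rewrite !mulmx2E !mxE /= ?conjC0 ?conjC1 ?B00 ?B11 ?pE ?qE.
- by ring.
- by rewrite uu; field; exact: pq_neq0.
- by field; exact: pq_neq0.
- by ring.
Qed.

End UnitaryReduction.

(** * Unitary conjugation as a *-automorphism *)

Section UnitaryConjugation.
Variables (C : numClosedFieldType) (n : nat) (U : 'M[C]_n.+1).
Hypothesis Uu : U \is unitarymx.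

(** The unitarity proof is an argument so that the structures of linear and multiplicative map can
    be attached to [uconj Uu]. *)
Definition uconj of U \is unitarymx := fun x : 'M[C]_n.+1 => U *m x *m U^t*.

Fact uconj_is_linear : linear (uconj Uu).
Proof.
by move=> a x y; rewrite /uconj mulmxDr mulmxDl -scalemxAr -scalemxAl.
Qed.

Fact uconj_is_monoid_morphism : monoid_morphism (uconj Uu).
Proof.
split=> [|x y]; rewrite /uconj; first by rewrite mulmx1 (unitarymxP Uu).
by rewrite -!mulmxE !mulmxA mulmxKtV.
Qed.

HB.instance Definition _ :=
  GRing.isLinear.Build C _ _ _ (uconj Uu) uconj_is_linear.
HB.instance Definition _ :=
  GRing.isMonoidMorphism.Build _ _ (uconj Uu) uconj_is_monoid_morphism.

Lemma uconj_bij : bijective (uconj Uu).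
Proof.
exists (fun x => U^t* *m x *m U) => x; rewrite /uconj.
  exact: unitary_conjK.
by rewrite !mulmxA (unitarymxP Uu) mul1mx mulmxtVK.
Qed.

Lemma uconj_adjoint x : uconj Uu (x ^t*) = (uconj Uu x) ^t*.
Proof. by rewrite /uconj !(trmx_mul, map_mxM) /= trmxCK mulmxA. Qed.

Lemma mxtrace_uconj x : \tr (uconj Uu x) = \tr x.
Proof. exact: mxtrace_unitary_conj. Qed.

End UnitaryConjugation.

Local Open Scope complex_scope.

(** * The KMS inner product and its orthogonal complements *)

Section QuantumGraphs.
Variable R : realType.
Local Notation C := R[i].
Local Notation M2 := 'M[C]_2.
Implicit Types (x y : M2) (S : {vspace M2}) (b : R).

Lemma rho_powD s t : rho_pow s *m rho_pow t = rho_pow (s + t) :> M2.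
Proof.
rewrite /rho_pow -scalar_mxM -rmorphM /= -powRD //; apply/implyP=> _.
exact: lt0r_neq0.
Qed.

Lemma rho_pow0 : rho_pow 0 = 1%:M :> M2.
Proof. by rewrite /rho_pow powRr0. Qed.

Lemma rho_powC t x : rho_pow t *m x = x *m rho_pow t.
Proof. exact/esym/scalar_mxC. Qed.

(** The powers of [rho] are scalar, so the two factors commute past [y] and combine to [2^-1]. *)
Lemma kmsE x y : kms x y = 2^-1 * \tr (x^t* *m y).
Proof.
rewrite /kms -(mulmxA (x^t*)) rho_powC !mulmxA -mulmxA rho_powD.
have -> : - 2^-1 - 2^-1 = -1 :> R by field.
rewrite /rho_pow powRN powRr1 // mul_mx_scalar mxtraceZ.
by rewrite fmorphV rmorph_nat.
Qed.

(** Scalar powers of [rho] with opposite exponents cancel on either side of [x]. *)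
Lemma adjacency_mapE (X : seq M2) x :
  adjacency_map X x = \sum_(Y <- X) Y *m x *m Y^t*.
Proof.
apply: eq_bigr => Y _.
rewrite (rho_powC _ Y) -(mulmxA Y) rho_powD addNr rho_pow0 mulmx1.
rewrite -(mulmxA (Y *m x *m _)) -(rho_powC _ (Y^t*)) mulmxA.
by rewrite -(mulmxA (Y *m x)) rho_powD subrr rho_pow0 mulmx1.
Qed.

Lemma kmsC x y : kms x y = (kms y x)^*%R.
Proof.
rewrite !kmsE rmorphM /= fmorphV rmorph_nat; congr (_ * _).
rewrite -[RHS]trace_map_mx -[RHS]mxtrace_tr map_trmx trmx_mul map_mxM /=.
by rewrite -map_trmx trmxCK.
Qed.

Lemma kms_eq0C x y : kms x y = 0 -> kms y x = 0.
Proof. by rewrite [kms y x]kmsC => ->; rewrite conjC0. Qed.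

Definition kms_form y (x : M2) : C^o := kms y x.

Fact kms_form_is_linear y : linear (kms_form y).
Proof.
move=> a x z; rewrite /kms_form !kmsE mulmxDr -scalemxAr linearD linearZ /=.
by rewrite mulrDr mulrCA.
Qed.

HB.instance Definition _ y :=
  GRing.isLinear.Build C M2 C^o _ (kms_form y) (kms_form_is_linear y).

(** Written as the kernel of a linear form, so that its dimension follows from rank-nullity. *)
Definition kms_orth y : {vspace M2} := lker (linfun (kms_form y)).

Lemma mem_kms_orth y x : (x \in kms_orth y) = (kms y x == 0).
Proof. by rewrite memv_ker lfunE. Qed.

(** Up to the factor 1/2, [kms x x] is the sum of the squared moduli of the entries. *)
Lemma kms_self_eq0 x : (kms x x == 0) = (x == 0).
Proof.
rewrite kmsE mulf_eq0 invr_eq0 pnatr_eq0 /= mxtrace2E !mulmx2E !mxE.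
rewrite ![_^* * _]mulrC -!normCK -!addrA.
apply/eqP/eqP => [/eqP|->]; last by rewrite !mxE normr0 expr0n /= !addr0.
rewrite !paddr_eq0 ?addr_ge0 ?exprn_ge0 // !expf_eq0 /= !normr_eq0.
by case/and4P => *; apply: eq_mx2; rewrite mxE; apply/eqP.
Qed.

(** The form has rank at most 1, and it is nonzero at [y] itself; the total dimension is 4. *)
Lemma dim_kms_orth y : y != 0 -> \dim (kms_orth y) = 3.
Proof.
move=> y0; have := limg_ker_dim (linfun (kms_form y)) fullv.
rewrite capfv dimvf dim_matrix /= => H.
have : (\dim (limg (linfun (kms_form y))) <= 1)%N.
  by rewrite (leq_trans (dimvS (subvf _))) // dimvf.
have : (\dim (limg (linfun (kms_form y))) != 0)%N.
  rewrite dimv_eq0; apply: contraNneq y0 => im0.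
  rewrite -kms_self_eq0.
  have := memv_img (linfun (kms_form y)) (memvf y).
  by rewrite im0 memv0 lfunE.
move: H; rewrite -/(kms_orth y); case: (\dim (limg _)) => [//|[|//]].
by rewrite addn1 => -[].
Qed.

Lemma kms1E x : kms 1%:M x = 2^-1 * \tr x.
Proof. by rewrite kmsE tr_scalar_mx map_scalar_mx /= conjC1 mul1mx. Qed.

Lemma kms1_eq0 x : (kms 1%:M x == 0) = (\tr x == 0).
Proof. by rewrite kms1E mulf_eq0 invr_eq0 pnatr_eq0. Qed.

Lemma kmsZr y (k : C) x : kms y (k *: x) = k * kms y x.
Proof. by rewrite !kmsE -scalemxAr mxtraceZ mulrCA. Qed.

Lemma kms_orthP y x : reflect (kms y x = 0) (x \in kms_orth y).
Proof. by rewrite mem_kms_orth; exact: eqP. Qed.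

Lemma loopfree_tr0 S x : loopfree S -> x \in S -> \tr x = 0.
Proof. by move=> lS /lS /eqP; rewrite kms1_eq0 => /eqP. Qed.

(** Loopfreeness puts [S] inside the traceless matrices, the complement of the identity, which also
    have dimension 3. *)
Lemma complete_loopfree_dim3 S :
  loopfree S -> \dim S = 3 -> complete_loopfree S.
Proof.
move=> lS dS.
suff -> : S = kms_orth 1%:M.
  by move=> x; rewrite mem_kms_orth kms1_eq0; split=> /eqP.
apply/eqP; rewrite eqEdim dS dim_kms_orth ?oner_neq0 // andbT.
by apply/subvP => x /lS; rewrite mem_kms_orth => ->.
Qed.

Lemma vline_pick S : \dim S = 1%N -> S = <[vpick S]>%VS.
Proof.
move=> dS; apply/eqP; rewrite eq_sym eqEdim dim_vline vpick0 -dimv_eq0 dS /=.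
rewrite andbT; exact: memv_pick.
Qed.

(** * Isomorphisms from unitaries, and existence of the parameter for one edge *)

Lemma tau_uconj (U : M2) (Uu : U \is unitarymx) x : tau (uconj Uu x) = tau x.
Proof. by rewrite /tau !mul_scalar_mx !linearZ /= mxtrace_uconj. Qed.

Lemma uconj_isomorphic (U : M2) (Uu : U \is unitarymx) S :
  qgraph_isomorphic S (linfun (uconj Uu) @: S).
Proof.
exists (uconj Uu); split; [exact: uconj_bij | exact: uconj_adjoint | | by []].
exact: tau_uconj.
Qed.

Lemma kms_uconj (U : M2) (Uu : U \is unitarymx) x y :
  kms (uconj Uu x) (uconj Uu y) = kms x y.
Proof.
by rewrite !kmsE -uconj_adjoint !mulmxE -(rmorphM (uconj Uu)) /= mxtrace_uconj.
Qed.

Definition edge1B b : M2 := mx2 0 (1 + b%:C) (1 - b%:C) 0.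

Lemma G1B_line b : G1B b = <[edge1B b]>%VS.
Proof. by congr (<[_]>%VS); apply: eq_mx2; rewrite !mxE. Qed.

Lemma tr_edge1B_sqr b : \tr (edge1B b *m edge1B b) = 2 * (1 - b%:C ^+ 2).
Proof. by rewrite mxtrace2E !mulmx2E !mxE /=; ring. Qed.

Lemma edge1B_adj b : (edge1B b)^t* = mx2 0 (1 - b%:C) (1 + b%:C) 0.
Proof.
have br : b%:C \is Num.real by rewrite complex_real.
by rewrite adjoint_mx2 conjC0 !conj_Creal ?realD ?realN ?real1.
Qed.

Lemma tr_edge1B_adj b : \tr ((edge1B b)^t* *m edge1B b) = 2 * (1 + b%:C ^+ 2).
Proof. by rewrite edge1B_adj mxtrace2E !mulmx2E !mxE /=; ring. Qed.

(** The two off-diagonal entries add up to 2, so they cannot both vanish. *)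
Lemma edge1B_neq0 b : edge1B b != 0.
Proof.
apply/eqP => /matrixP e0; have := e0 0 1; have := e0 1 0.
rewrite !mxE /= => e1 e2.
have : (1 + b%:C) + (1 - b%:C) = 2 :> C by ring.
by rewrite e1 e2 addr0 => /eqP; rewrite eq_sym pnatr_eq0.
Qed.

Lemma traceless_edge1B x : \tr x = 0 -> x != 0 ->
  exists (U : M2) (Uu : U \is unitarymx) (c : C) b,
    [/\ c != 0, 0 <= b <= 1 & uconj Uu x = c *: edge1B b].
Proof.
move=> tr0 x0; have [U [c [z [Uu c0 z01 E]]]] := traceless_normal_form tr0 x0.
(* The normal form yields a complex parameter in [[0, 1]]; being real, it comes from [R]. *)
have /complex_realP [b zb] : z \is Num.real.
  by rewrite ger0_real; case/andP: z01.
exists U, Uu, c, b; split; [exact: c0 | by rewrite -!lecR -zb |].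
by rewrite /edge1B -zb.
Qed.

Lemma vlineZ (c : C) x : c != 0 -> (<[c *: x]> = <[x]>)%VS.
Proof.
move=> c0; apply/eqP; rewrite eqEsubv -!memvE memvZ ?memv_line //=.
by rewrite -{1}[x](scalerK c0) memvZ ?memv_line.
Qed.

Lemma one_edge_isomorphic S : loopfree S -> \dim S = 1%N ->
  exists b, 0 <= b <= 1 /\ qgraph_isomorphic S (G1B b).
Proof.
move=> lS dS; have S0 : vpick S != 0 by rewrite vpick0 -dimv_eq0 dS.
have [U [Uu [c [b [c0 b01 E]]]]] :=
  traceless_edge1B (loopfree_tr0 lS (memv_pick S)) S0.
exists b; split=> //.
suff -> : G1B b = (linfun (uconj Uu) @: S)%VS by exact: uconj_isomorphic.
rewrite [in RHS](vline_pick dS) limg_line lfunE [X in <[X]>%VS]E.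
by rewrite vlineZ ?G1B_line.
Qed.

(** * Uniqueness of the parameter *)

Lemma tau_inj_tr x y : tau x = tau y -> \tr x = \tr y.
Proof.
rewrite /tau !mul_scalar_mx !linearZ /=; apply: mulfI.
by rewrite pnatr_eq0.
Qed.

(** An isomorphism sends [x] to some [c *: edge1B b] and preserves both traces. The modulus removes
    the phase of [c], so the common factor is [2 * |c| ^+ 2]. *)
Lemma isomorphic_G1B_invariant x b : 0 <= b <= 1 ->
  qgraph_isomorphic <[x]> (G1B b) ->
  exists2 u : C, u != 0 &
    u * (1 - b%:C ^+ 2) = `|\tr (x *m x)| /\
    u * (1 + b%:C ^+ 2) = \tr (x^t* *m x).
Proof.
case/andP=> b0 b1 [f [_ f_adj f_tau]]; rewrite limg_line lfunE G1B_line => fx.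
have /vlineP [c fxE] : f x \in <[edge1B b]>%VS by rewrite -fx memv_line.
have c0 : c != 0.
  apply: contraNneq (edge1B_neq0 b) => c0.
  have : edge1B b \in <[f x]>%VS by rewrite fx memv_line.
  by rewrite fxE c0 scale0r => /vlineP [k ->]; rewrite scaler0.
exists (2 * `|c| ^+ 2).
  by rewrite mulf_neq0 ?pnatr_eq0 ?expf_neq0 ?normr_eq0.
split.
  rewrite -(tau_inj_tr (f_tau _)) mulmxE rmorphM /= fxE -mulmxE.
  rewrite -scalemxAl -scalemxAr !mxtraceZ tr_edge1B_sqr !normrM normr_nat.
  rewrite [`|1 - _|]ger0_norm; first by ring.
  by rewrite subr_ge0 -rmorphXn lecR expr_le1.
rewrite -(tau_inj_tr (f_tau _)) mulmxE rmorphM /= f_adj fxE -mulmxE.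
rewrite adjointZ -scalemxAl -scalemxAr !mxtraceZ tr_edge1B_adj.
by rewrite normCK; ring.
Qed.

Lemma G1B_unique x b1 b2 : 0 <= b1 <= 1 -> 0 <= b2 <= 1 ->
  qgraph_isomorphic <[x]> (G1B b1) -> qgraph_isomorphic <[x]> (G1B b2) ->
  b1 = b2.
Proof.
move=> b1P b2P /(isomorphic_G1B_invariant b1P) [u u0 [um up]].
move=> /(isomorphic_G1B_invariant b2P) [v v0 [vm vp]].
(* Adding the two invariants eliminates the parameter and leaves [2 * u], respectively [2 * v]. *)
have uv : u = v.
  apply: (@mulfI _ 2); first by rewrite pnatr_eq0.
  transitivity (u * (1 - b1%:C ^+ 2) + u * (1 + b1%:C ^+ 2)); first by ring.
  by rewrite um up -vm -vp; ring.
move: up; rewrite -vp uv => /(mulfI v0) /addrI.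
rewrite -!rmorphXn => /complexI /eqP.
by rewrite eqrXn2 //; [move/eqP | case/andP: b1P | case/andP: b2P].
Qed.

(** * The adjacency matrix of [G1B] *)

Lemma orthonormal_basis_line x (X : seq M2) : x != 0 ->
  orthonormal_basis <[x]> X <->
  exists2 k : C, X = [:: k *: x] & k * k^*%R * kms x x = 1.
Proof.
have kmsZ k : kms (k *: x) (k *: x) = k * k^*%R * kms x x.
  rewrite !kmsE adjointZ -scalemxAl -scalemxAr !mxtraceZ; ring.
move=> x0; split=> [[bX oX]|[k -> kk]].
  have sX : size X = 1%N.
    by rewrite -(size_basis (X := in_tuple X) bX) dim_vline x0.
  case: X sX bX oX => [//|y [|//]] _ bX oX.
  have /vlineP [k yE] : y \in <[x]>%VS.
    by apply: basis_mem bX _; rewrite mem_head.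
  by exists k; rewrite ?yE -?kmsZ -?yE ?oX //; have := oX 0 0 isT isT.
have k0 : k != 0.
  by apply: contra_eq_neq kk => ->; rewrite !mul0r eq_sym oner_eq0.
split; first by rewrite basisEdim span_seq1 dim_vline x0 vlineZ ?subvv.
by case=> [|//] [|//] _ _; rewrite /= kmsZ kk.
Qed.

Lemma kms_edge1B b : kms (edge1B b) (edge1B b) = 1 + b%:C ^+ 2.
Proof. by rewrite kmsE tr_edge1B_adj mulKf ?pnatr_eq0. Qed.

Lemma edge1B_norm_neq0 b : 1 + b%:C ^+ 2 != 0.
Proof. by rewrite -kms_edge1B kms_self_eq0 edge1B_neq0. Qed.

(** Only the squared modulus of [k] enters, and normalization fixes it to the inverse of
    [1 + b ^+ 2]; hence the phase of the basis vector does not matter. *)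
Lemma matrix_of_adjacency_map1 (k : C) b :
  k * k^*%R * kms (edge1B b) (edge1B b) = 1 ->
  matrix_of_map (adjacency_map [:: k *: edge1B b]) = A1B b.
Proof.
rewrite kms_edge1B => kk.
have kE : k * k^*%R = (1 + b%:C ^+ 2)^-1.
  by rewrite -[LHS](mulfK (edge1B_norm_neq0 b)) kk mul1r.
apply/matrixP=> p q; rewrite mxE adjacency_mapE big_seq1 mulmx_delta_mx.
rewrite adjointZ edge1B_adj !mxE mulrACA kE; congr (_ * _).
have inord0 : inord 0 = 0 :> 'I_2 by apply: val_inj; rewrite /= inordK.
have inord1 : inord 1 = 1 :> 'I_2 by apply: val_inj; rewrite /= inordK.
move: p q; do 2!apply: forall_ord4; rewrite !inordK //=.
all: rewrite ?inord0 ?inord1 /=.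
all: by [ | ring].
Qed.

Lemma adjacency_matrix_G1B b A : is_adjacency_matrix (G1B b) A <-> A = A1B b.
Proof.
rewrite /is_adjacency_matrix G1B_line; split.
  move=> [X /(orthonormal_basis_line _ (edge1B_neq0 b)) [k -> kk] ->].
  exact: matrix_of_adjacency_map1.
(* A nonnegative real normalizing factor: the root of the inverse squared norm. *)
move=> ->; pose k : C := sqrtC (1 + b%:C ^+ 2)^-1.
have kk : k * k^*%R * kms (edge1B b) (edge1B b) = 1.
  rewrite kms_edge1B (conj_Creal (x := k)) -?expr2 ?sqrtCK.
    by rewrite mulVf ?edge1B_norm_neq0.
  rewrite ger0_real // sqrtC_ge0 invr_ge0 addr_ge0 //.
  by rewrite -rmorphXn lecR sqr_ge0.
exists [:: k *: edge1B b]; last by rewrite matrix_of_adjacency_map1.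
by apply/orthonormal_basis_line; [exact: edge1B_neq0 | exists k].
Qed.

(** * Undirectedness and spectrum of [G1B] *)

Lemma undirected_G1B b : undirected (G1B b) <-> b = 0.
Proof.
rewrite /undirected G1B_line; split=> [und|b0].
  have /und [_ /vlineP [k ->]] := memv_line (edge1B b).
  rewrite adjointZ edge1B_adj => /matrixP E.
  have := E 0 1; have := E 1 0; rewrite !mxE /=; move: (k^*%R) => h e1 e2.
  (* Each off-diagonal entry is [h] times the other, so both squares equal [h * (1 + b) * (1 - b)].
     Their difference is [4 * b]. *)
  have e : (1 + b%:C) ^+ 2 = (1 - b%:C) ^+ 2 :> C.
    by rewrite !expr2 {1}e2 [X in _ = X * _]e1; ring.
  apply: complexI; apply: (@mulfI _ 4); first by rewrite pnatr_eq0.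
  by rewrite mulr0 -(subrr ((1 + b%:C) ^+ 2)) {2}e; ring.
have adjZ (k : C) : (k *: edge1B b)^t* = k^*%R *: edge1B b.
  by rewrite adjointZ edge1B_adj /edge1B b0 subr0 addr0.
move=> y; split=> [/vlineP [k ->]|[_ /vlineP [k ->] ->]].
  by exists (k^*%R *: edge1B b); rewrite ?memvZ ?memv_line // adjZ conjCK.
by rewrite adjZ memvZ ?memv_line.
Qed.

(** Both minors given by [det_cross] equal ['X ^+ 2 - (n * (1 - z ^+ 2)) ^+ 2], so each of the two
    opposite roots is counted twice. *)
Lemma spectrum_A1B b : has_spectrum (A1B b) (sigma1B b).
Proof.
rewrite /has_spectrum /sigma1B /A1B /char_poly; move: (b%:C) => z.
set n := (1 + z ^+ 2)^-1.
rewrite (_ : char_poly_mx _ = \matrix_(i < 4, j < 4) (nth [::]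
   [:: [:: 'X; 0; 0; - (n * (1 + z) ^+ 2)%:P];
       [:: 0; 'X; - (n * (1 - z ^+ 2))%:P; 0];
       [:: 0; - (n * (1 - z ^+ 2))%:P; 'X; 0];
       [:: - (n * (1 - z) ^+ 2)%:P; 0; 0; 'X]] i)`_j).
  rewrite det_cross /= !big_cons big_nil.
  by rewrite !(rmorphM, rmorphB, rmorphD, rmorphXn, rmorph1) /=; ring.
apply/matrixP; do 2!apply: forall_ord4; rewrite !mxE -val_eqE /= !inordK //=.
all: by rewrite ?mulr0 ?subr0 ?sub0r ?oppr0.
Qed.

(** * Two edges: the loopfree complement *)

Lemma exists_kms_orthogonal S : \dim S = 2 ->
  exists x, [/\ x != 0, \tr x = 0 & forall s, s \in S -> kms x s = 0].
Proof.
move=> dS; have := size_tuple (vbasis S); rewrite [RHS]dS.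
case: (tval (vbasis S)) (vbasisP S) => [//|s1 [//|s2 [|//]]] bS _.
have s10 : s1 != 0 by apply: basis_not0 bS _; rewrite mem_head.
have s20 : s2 != 0 by apply: basis_not0 bS _; rewrite !inE eqxx orbT.
(* Three hyperplanes of a 4-dimensional space share a nonzero vector; the third one imposes trace
   zero. *)
pose V := (kms_orth s1 :&: kms_orth s2 :&: kms_orth 1%:M)%VS.
have dle (W : {vspace M2}) : (\dim W <= 4)%N.
  by rewrite (leq_trans (dimvS (subvf _))) // dimvf dim_matrix.
have dV : (0 < \dim V)%N.
  have dcap (W W' : {vspace M2}) p : \dim W = p -> \dim W' = 3 ->
      (p <= (\dim (W :&: W')).+1)%N.
    move=> dW dW'; have := dimv_sum_cap W W'; rewrite dW dW'.
    have := dle (W + W')%VS; lia.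
  have d3 := dcap (kms_orth s1 :&: kms_orth s2)%VS _ _ erefl
                  (dim_kms_orth (oner_neq0 _)).
  have d12 := dcap _ _ _ (dim_kms_orth s10) (dim_kms_orth s20).
  by move: d12; rewrite ltnS => d12; have := leq_trans d12 d3; rewrite ltnS.
have := memv_pick V; set x := vpick V.
rewrite 2!memv_cap => /andP[/andP[/kms_orthP x1 /kms_orthP x2] /kms_orthP /eqP].
rewrite kms1_eq0 => /eqP trx.
exists x; split; [by rewrite vpick0 -dimv_eq0 -lt0n | exact: trx |].
move=> s; rewrite -(span_basis bS) => sS.
have /subvP VS : (<<[:: s1; s2]>> <= kms_orth x)%VS.
  apply/span_subvP => z; rewrite !inE => /orP[]/eqP ->; apply/kms_orthP.
    exact: kms_eq0C x1.
  exact: kms_eq0C x2.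
exact/kms_orthP/VS.
Qed.

Lemma two_edges_complement S : loopfree S -> \dim S = 2 ->
  exists b, 0 <= b <= 1 /\
    exists2 S', loopfree_complement (G1B b) S' & qgraph_isomorphic S S'.
Proof.
move=> lS dS; have [x [x0 trx xS]] := exists_kms_orthogonal dS.
have [U [Uu [c [b [c0 b01 E]]]]] := traceless_edge1B trx x0.
exists b; split=> //; exists (linfun (uconj Uu) @: S)%VS;
  last exact: uconj_isomorphic.
set S' := (_ @: S)%VS.
have trS' y : y \in S' -> \tr y = 0.
  by case/memv_imgP=> s sS ->; rewrite lfunE /= mxtrace_uconj (loopfree_tr0 lS).
have orthS' y : y \in S' -> kms y (edge1B b) = 0.
  case/memv_imgP=> s sS ->; rewrite lfunE /=; apply/eqP.
  have := kms_uconj Uu s x; rewrite (kms_eq0C (xS s sS)) E kmsZr => /eqP.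
  by rewrite mulf_eq0 (negbTE c0).
(* A scalar matrix of trace zero vanishes, so the sum with the identity line is direct. *)
have dirS' : (S' :&: <[1%:M]> = 0)%VS.
  apply/eqP; rewrite -subv0; apply/subvP => y; rewrite memv_cap memv0.
  case/andP=> /trS' try /vlineP [k yE]; move: try.
  rewrite yE mxtraceZ mxtrace1 => /eqP.
  rewrite mulf_eq0 pnatr_eq0 orbF => /eqP ->.
  by rewrite scale0r.
have dS' : \dim S' = 2.
  rewrite limg_dim_eq //; have /eqP -> : lker (linfun (uconj Uu)) == 0%VS.
    by apply/lker0P => y z; rewrite !lfunE => /(bij_inj (uconj_bij Uu)).
  by rewrite capv0.
(* The images of [S] and the identity are orthogonal to [edge1B b], and both sides have dimension
   3. *)
have SE : (S' + <[1%:M]>)%VS = kms_orth (edge1B b).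
  apply/eqP; rewrite eqEdim dimv_disjoint_sum // dS' dim_vline oner_neq0.
  rewrite dim_kms_orth ?edge1B_neq0 // andbT subv_add -memvE mem_kms_orth.
  apply/andP; split.
    by apply/subvP=> y /orthS'; rewrite mem_kms_orth => /kms_eq0C ->.
  apply/eqP; apply: kms_eq0C; apply/eqP.
  by rewrite kms1_eq0 mxtrace2E !mxE /= addr0.
split; last by move=> y /trS' try; apply/eqP; rewrite kms1_eq0 try.
  move=> y; rewrite SE mem_kms_orth G1B_line.
  split=> [/eqP y0 s /vlineP [k ->]|].
    by apply: kms_eq0C; rewrite kmsZr (kms_eq0C y0) mulr0.
  by move=> /(_ _ (memv_line _)) ->.
exact/directv_addP.
Qed.

End QuantumGraphs.

(** * Assembly of the three cases *)

Theorem theorem1p1 (R : realType) (S : {vspace 'M[R[i]]_2})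
    (S_loopfree : loopfree S) :
  [/\ (\dim S = 1%N ->
         exists! beta : R, 0 <= beta <= 1 /\ qgraph_isomorphic S (G1B beta)) /\
      (forall beta : R, 0 <= beta <= 1 ->
         [/\ forall A, is_adjacency_matrix (G1B beta) A <-> A = A1B beta,
             undirected (G1B beta) <-> beta = 0 &
             forall A, is_adjacency_matrix (G1B beta) A ->
               has_spectrum A (sigma1B beta)]),
      \dim S = 2%N ->
        (exists beta : R, 0 <= beta <= 1 /\
           exists2 S', loopfree_complement (G1B beta) S' &
                       qgraph_isomorphic S S') &
      \dim S = 3%N -> complete_loopfree S].
Proof.
split; [split | exact: two_edges_complement | exact: complete_loopfree_dim3].
  move=> dS; have [b [b01 bS]] := one_edge_isomorphic S_loopfree dS.
  (* [G1B_unique] speaks of a line, so [S] is rewritten as the span of its picked vector. *)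
  exists b; split=> // b' [b'01 b'S]; rewrite (vline_pick dS) in bS b'S.
  exact: G1B_unique b01 b'01 bS b'S.
move=> b _; split; [exact: adjacency_matrix_G1B | exact: undirected_G1B |].
by move=> A /adjacency_matrix_G1B ->; exact: spectrum_A1B.
Qed.
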